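(* Let $(X,D)$ be an $\mathcal{F}$-metric space with $(f,\alpha)\in\mathcal{F}\times[0,\infty)$. Then $X$ is $\mathcal{F}$-complete if and only if for every decreasing sequence $\{F_n\}_{n\in\mathbb{N}}$ (i.e. $F_{n+1}\subseteq F_n$ for all $n$) of non-empty $\mathcal{F}$-closed subsets of $X$ with $\mathrm{diam}_D(F_n)\to 0$ as $n\to\infty$, the intersection $\bigcap_{i=1}^{\infty}F_i$ consists of exactly one point.
   Context: $\mathcal{F}$ denotes the class of functions $f:(0,\infty)\to\mathbb{R}$ such that: ($\mathcal{F}_1$) $f$ is non-decreasing, i.e. $0<s<t$ implies $f(s)\le f(t)$; ($\mathcal{F}_2$) for every sequence $\{t_n\}_{n\in\mathbb{N}}\subseteq(0,\infty)$, $\lim_{n\to\infty}t_n=0$ if and only if $\lim_{n\to\infty}f(t_n)=-\infty$. Let $X$ be a non-empty set and $D:X\times X\to[0,\infty)$ a mapping. $(X,D)$ is an $\mathcal{F}$-metric space with $(f,\alpha)\in\mathcal{F}\times[0,\infty)$ if: (D1) for all $x,y\in X$, $D(x,y)=0$ if and only if $x=y$; (D2) $D(x,y)=D(y,x)$ for all $x,y\in X$; (D3) for every $(x,y)\in X\times X$, every $N\in\mathbb{N}$ with $N\ge 2$, and every $(u_i)_{i=1}^{N}\subseteq X$ with $(u_1,u_N)=(x,y)$, if $D(x,y)>0$ then $f(D(x,y))\le f\left(\sum_{i=1}^{N-1}D(u_i,u_{i+1})\right)+\alpha$. For $x\in X$, $r>0$ let $B_D(x,r)=\{y\in X: D(x,y)<r\}$.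 A set $O\subseteq X$ is $\mathcal{F}$-open if for every $x\in O$ there is $r>0$ with $B_D(x,r)\subseteq O$; the $\mathcal{F}$-open sets form the topology $\tau_{\mathcal{F}}$ on $X$. A set is $\mathcal{F}$-closed if its complement in $X$ is $\mathcal{F}$-open. A sequence $\{x_n\}$ in $X$ is $\mathcal{F}$-convergent to $x\in X$ if it converges to $x$ in $\tau_{\mathcal{F}}$ (equivalently, $D(x_n,x)\to 0$), and is $\mathcal{F}$-Cauchy if $\lim_{n,m\to\infty}D(x_n,x_m)=0$. $X$ is $\mathcal{F}$-complete if every $\mathcal{F}$-Cauchy sequence in $X$ is $\mathcal{F}$-convergent to some element of $X$. For non-empty $A\subseteq X$, $\mathrm{diam}_D(A)=\sup\{D(x,y):x,y\in A\}\in[0,\infty]$. *)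

(* Defs.v *)
From HB Require Import structures.
From mathcomp Require Export all_boot all_order all_algebra.
From mathcomp Require Export all_classical all_reals all_analysis.
Export numFieldNormedType.Exports.

Set Implicit Arguments.
Unset Strict Implicit.
Unset Printing Implicit Defensive.

Import Order.TTheory GRing.Theory Num.Theory.

Local Open Scope classical_set_scope.
Local Open Scope ring_scope.

(* A function f : (0, +oo) -> R is represented by a total function R -> R
   of which only the values at positive arguments are constrained or used. *)
Record class_F (R : realType) (f : R -> R) : Prop := {
  class_F1 : forall s t : R, 0 < s -> s < t -> f s <= f t;
  class_F2 : forall t_ : nat -> R, (forall n, 0 < t_ n) ->
    (t_ n @[n --> \oo] --> (0 : R)) <-> (f (t_ n) @[n --> \oo] --> -oo)
}.

(* In Fmetric_D3 the points u_1, ..., u_N are the values of u : nat -> X at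
   1, ..., N; the other values of u are irrelevant. Since D x y > 0, Fmetric_D1
   makes the sum positive, so f is only evaluated on (0, +oo). *)
Record is_Fmetric (R : realType) (X : Type) (D : X -> X -> R) (f : R -> R)
    (alpha : R) : Prop := {
  Fmetric_class : class_F f;
  Fmetric_alpha_ge0 : 0 <= alpha;
  Fmetric_ge0 : forall x y : X, 0 <= D x y;
  Fmetric_D1 : forall x y : X, D x y = 0 <-> x = y;
  Fmetric_D2 : forall x y : X, D x y = D y x;
  Fmetric_D3 : forall (x y : X) (N : nat) (u : nat -> X),
    (2 <= N)%N -> u 1%N = x -> u N = y -> 0 < D x y ->
    f (D x y) <= f (\sum_(1 <= i < N) D (u i) (u i.+1)) + alpha
}.

Section Ftopology.
Context {R : realType} {X : Type}.
Implicit Types (D : X -> X -> R) (A O : set X).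

Definition F_ball D (x : X) (r : R) : set X := [set y | D x y < r].

Definition F_open D O : Prop :=
  forall x, O x -> exists2 r : R, 0 < r & F_ball D x r `<=` O.

Definition F_closed D A : Prop := F_open D (~` A).

Lemma F_openT D : F_open D setT.
Proof. by move=> x _; exists 1. Qed.

Lemma F_openI D : setI_closed (F_open D).
Proof.
move=> A B oA oB x [/oA[r r0 rA] /oB[s s0 sB]].
exists (Num.min r s); first by rewrite lt_min r0.
by move=> y; rewrite /F_ball /= lt_min => /andP[/rA ? /sB].
Qed.

Lemma F_open_bigU D (I : Type) (O : I -> set X) :
  (forall i, F_open D (O i)) -> F_open D (\bigcup_i O i).
Proof.
move=> oO x [i _ /oO[r r0 rO]]; exists r => // y /rO Oy.
by exists i.
Qed.

End Ftopology.

(* X equipped with the topology whose open sets are the F_open D sets. *)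
Definition F_space (R : realType) (X : Type) (D : X -> X -> R) : Type := X.

HB.instance Definition _ (R : realType) (X : Type) (D : X -> X -> R) :=
  gen_eqMixin (F_space D).
HB.instance Definition _ (R : realType) (X : Type) (D : X -> X -> R) :=
  gen_choiceMixin (F_space D).
HB.instance Definition _ (R : realType) (X : Type) (D : X -> X -> R) :=
  @isOpenTopological.Build (F_space D) (F_open D)
    (F_openT D) (@F_openI R X D) (@F_open_bigU R X D).

Section Fcompleteness.
Context {R : realType} {X : Type}.
Implicit Types (D : X -> X -> R) (u : nat -> X).

Definition F_converges D u (x : X) : Prop :=
  (u : nat -> F_space D) @ \oo --> (x : F_space D).

Definition F_cauchy D u : Prop :=
  D (u nm.1) (u nm.2) @[nm --> filter_prod \oo \oo] --> (0 : R).

Definition F_complete D : Prop :=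
  forall u, F_cauchy D u -> exists x, F_converges D u x.

Definition F_diam D (A : set X) : \bar R :=
  ereal_sup [set (D p.1 p.2)%:E | p in A `*` A].

End Fcompleteness.

(* Main.v *)
Require Import Defs.

Set Implicit Arguments.
Unset Strict Implicit.
Unset Printing Implicit Defensive.

Import Order.TTheory GRing.Theory Num.Theory.

Local Open Scope classical_set_scope.
Local Open Scope ring_scope.

(** Axioms (D3) and (F2) give a uniform substitute for the triangle
    inequality: [D x z < e] as soon as [D x y] and [D y z] are both smaller than
    some [r > 0] depending only on [e].  Hence the set of points at distance zero
    from a tail of a Cauchy sequence is closed and has small diameter, and the
    classical proof of Cantor's theorem goes through. *)

(** By (F2), [f] tends to [-oo] along [1/(n+1)], so one of these points has a value below
    [f e - alpha]; monotonicity extends the bound to every smaller positive [t]. *)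
Lemma class_F_gap {R : realType} (f : R -> R) (alpha e : R) :
  class_F f -> exists2 r, 0 < r & forall t, 0 < t -> t < r -> f t + alpha < f e.
Proof.
move=> [f1 f2].
pose t n : R := n.+1%:R^-1.
have t0 n : 0 < t n by rewrite invr_gt0.
have /cvgrNyPlt/(_ (f e - alpha)) : f (t n) @[n --> \oo] --> -oo.
  by apply/(f2 _ t0); exact: cvg_harmonic.
move=> [n _ /(_ n (leqnn n)) /= fn].
exists (t n) => // s s0 sn; rewrite -ltrBrDr.
exact: le_lt_trans (f1 _ _ s0 sn) fn.
Qed.

Lemma nneg_ereal_cvg0P {R : realType} (d : nat -> \bar R) :
  (forall n, (0 <= d n)%E) ->
  d n @[n --> \oo] --> (0%R%:E : \bar R) <->
  forall e : R, 0 < e -> \forall n \near \oo, (d n <= e%:E)%E.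
Proof.
move=> d0; split.
- move=> /fine_cvgP[dfin /cvgrPdist_le dcvg] e /dcvg de.
  near=> n.
  have dn : d n \is a fin_num by near: n.
  rewrite -(fineK dn) lee_fin.
  have : `|0 - fine (d n)| <= e by near: n.
  by rewrite sub0r normrN ger0_norm// fine_ge0.
- move=> de; apply/fine_cvgP.
  (* Early terms may be [+oo]; the bound at tolerance 1 makes the terms eventually finite. *)
  have fin e : (d e <= 1%:E)%E -> d e \is a fin_num.
    by move=> d1; rewrite ge0_fin_numE// (le_lt_trans d1)// ltry.
  split; first by near=> n; apply: fin; near: n; exact: de.
  apply/cvgrPdist_le => e e0; near=> n.
  have dn : d n \is a fin_num by apply: fin; near: n; exact: de.
  rewrite sub0r normrN ger0_norm ?fine_ge0// -lee_fin fineK//.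
  by near: n; exact: de.
Unshelve. all: by end_near. Qed.

Section Fmetric_theory.
Context {R : realType} {X : Type} (D : X -> X -> R).

Lemma F_cauchyP (u : nat -> X) : (forall x y, 0 <= D x y) ->
  F_cauchy D u <->
  forall e, 0 < e -> exists N, forall n m, (N <= n)%N -> (N <= m)%N ->
    D (u n) (u m) < e.
Proof.
move=> D0; split.
- move=> /cvgrPdist_lt cu e /cu[[A B] /= [[N1 _ A1] [N2 _ B2]] AB].
  exists (maxn N1 N2) => n m; rewrite !geq_max => /andP[n1 _] /andP[_ m2].
  have := AB (n, m) (conj (A1 _ n1) (B2 _ m2)).
  by rewrite /= sub0r normrN ger0_norm.
- move=> cu; apply/cvgrPdist_lt => e /cu[N uN].
  exists ([set n | (N <= n)%N], [set n | (N <= n)%N]) => /=.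
    by split; exists N.
  by move=> [n m] /= [Nn Nm]; rewrite sub0r normrN ger0_norm//; exact: uN.
Qed.

Lemma F_convergesP (u : nat -> X) (x : X) :
  F_converges D u x <->
  forall O, F_open D O -> O x -> \forall n \near \oo, O (u n).
Proof.
split=> [ux O oO Ox|ux].
  by apply: ux; apply: open_nbhs_nbhs; split.
move=> A /=; rewrite nbhsE => -[U [oU Ux] UA].
by apply: filterS (ux U oU Ux) => n; exact: UA.
Qed.

Lemma F_converges_dist (u : nat -> X) (x : X) :
  (forall e, 0 < e -> \forall n \near \oo, D x (u n) < e) -> F_converges D u x.
Proof.
move=> Du; apply/F_convergesP => O oO /oO[r r0 rO].
by apply: filterS (Du r r0) => n; exact: rO.
Qed.

(** Were [x] outside [A], the open complement of [A] would eventually contain the sequence. This is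
    purely topological, so balls need not be neighbourhoods. *)
Lemma F_closed_limit (A : set X) (u : nat -> X) (x : X) :
  F_closed D A -> F_converges D u x -> (\forall n \near \oo, A (u n)) -> A x.
Proof.
move=> cA /F_convergesP ux Au; apply: contrapT => nAx.
have [n [An]] := filter_ex (filterI Au (ux _ cA nAx)).
exact.
Qed.

Lemma F_diam_ub (A : set X) (x y : X) : A x -> A y ->
  ((D x y)%:E <= F_diam D A)%E.
Proof. by move=> Ax Ay; apply: ereal_sup_ubound; exists (x, y). Qed.

Lemma F_diam_le (A : set X) (e : R) :
  (forall x y, A x -> A y -> D x y <= e) -> (F_diam D A <= e%:E)%E.
Proof.
move=> Ae; apply: ge_ereal_sup => _ [[x y] [Ax Ay] <-].
by rewrite lee_fin; exact: Ae.
Qed.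

(** Non-emptiness excludes [-oo], the supremum of the empty set. *)
Lemma F_diam_ge0 (A : set X) : (forall x y, 0 <= D x y) -> A !=set0 ->
  (0 <= F_diam D A)%E.
Proof.
by move=> D0 [x Ax]; rewrite (le_trans _ (F_diam_ub Ax Ax))// lee_fin.
Qed.

(* Balls need not be open, so this is not the topological closure by definition;
   its closedness rests on the uniform triangle inequality. *)
Definition F_adherence (A : set X) : set X :=
  [set x | forall e, 0 < e -> exists2 a, A a & D x a < e].

Variables (f : R -> R) (alpha : R) (hD : is_Fmetric D f alpha).

(** If [e <= D x z], then (D3) for the chain [x, y, z] gives [f e <= f (D x y + D y z) + alpha],
    which the gap property forbids for a small sum. *)
Lemma Fmetric_uniform_triangle (e : R) : 0 < e ->
  exists2 r, 0 < r & forall x y z, D x y < r -> D y z < r -> D x z < e.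
Proof.
move=> e0; have [r r0 fr] := class_F_gap alpha e (Fmetric_class hD).
(* Halving keeps the sum of the two distances below [r]. *)
exists (r / 2); first by rewrite divr_gt0.
move=> x y z xy yz; rewrite ltNge; apply/negP => exz.
have xz0 : 0 < D x z by exact: lt_le_trans exz.
pose u n := if n == 1%N then x else if n == 2%N then y else z.
have := Fmetric_D3 hD (u := u) (isT : (2 <= 3)%N) erefl erefl xz0.
rewrite big_nat_recr//= big_nat1 /u/=.
(* The gap bound holds at positive arguments only; a zero sum would force [x = y = z], against
   [0 < D x z]. *)
have xyz0 : 0 < D x y + D y z.
  rewrite lt_neqAle addr_ge0 ?(Fmetric_ge0 hD)// andbT eq_sym.
  rewrite paddr_eq0 ?(Fmetric_ge0 hD)//; apply/negP => /andP[/eqP + /eqP].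
  move=> /(Fmetric_D1 hD) xy0 /(Fmetric_D1 hD) yz0.
  by move: xz0; rewrite xy0 yz0 (Fmetric_D1 hD _ _).2 ?ltxx.
have xyzr : D x y + D y z < r by rewrite [r]splitr ltrD.
have fexz : f e <= f (D x z).
  move: exz; rewrite le_eqVlt => /predU1P[->//|].
  exact: class_F1 (Fmetric_class hD) _ _ e0.
move=> /(le_trans fexz); apply/negP; rewrite -ltNge; exact: fr.
Qed.

Lemma subset_F_adherence (A : set X) : A `<=` F_adherence A.
Proof. by move=> x Ax e e0; exists x => //; rewrite (Fmetric_D1 hD _ _).2. Qed.

(** If [x] stays [e] away from [A], a point [y] within [r] of [x] cannot be within [r] of some [a]
    in [A], since then [D x a < e]. *)
Lemma F_closed_adherence (A : set X) : F_closed D (F_adherence A).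
Proof.
move=> x nAx.
have [e e0 nA] : exists2 e, 0 < e & forall a, A a -> ~ D x a < e.
  apply: contrapT => nex; apply: nAx => e e0; apply: contrapT => nA.
  by apply: nex; exists e => // a Aa xa; apply: nA; exists a.
have [r r0 tri] := Fmetric_uniform_triangle e0.
exists r => // y xy /(_ r r0)[a Aa ya].
exact: (nA a Aa (tri _ _ _ xy ya)).
Qed.

(** Choose [a] and [b] in [A] near [x] and [y]. The uniform triangle inequality is used twice: from
    [x] to [b] through [a], then from [x] to [y] through [b]. *)
Lemma F_adherence_small (e : R) : 0 < e -> exists2 r, 0 < r &
  forall A, (forall a b, A a -> A b -> D a b < r) ->
    forall x y, F_adherence A x -> F_adherence A y -> D x y < e.
Proof.
move=> /Fmetric_uniform_triangle[r r0 tri].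
have [s s0 tri'] := Fmetric_uniform_triangle r0.
exists s => // A As x y /(_ s s0)[a Aa xa] /(_ r r0)[b Ab yb].
apply: (tri _ b); last by rewrite (Fmetric_D2 hD).
by apply: tri' xa _; exact: As.
Qed.

Lemma F_complete_Cantor (F : nat -> set X) : F_complete D ->
  (forall n, F n.+1 `<=` F n) ->
  (forall n, F n !=set0) ->
  (forall n, F_closed D (F n)) ->
  F_diam D (F n) @[n --> \oo] --> (0%R%:E : \bar R) ->
  exists x : X, \bigcap_n F n = [set x].
Proof.
move=> cD Fdec F0 Fcl /nneg_ereal_cvg0P diamF.
have {}diamF e : 0 < e ->
    exists N, forall x y, F N x -> F N y -> D x y <= e.
  move=> /diamF[|N _ /(_ N (leqnn N)) diamN].
    by move=> n; apply: F_diam_ge0 => //; exact: Fmetric_ge0 hD.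
  exists N => x y Fx Fy; rewrite -lee_fin.
  exact: le_trans (F_diam_ub Fx Fy) diamN.
have Fsub n m : (n <= m)%N -> F m `<=` F n.
  elim: m => [|m IH]; first by rewrite leqn0 => /eqP->.
  rewrite leq_eqVlt => /predU1P[->//|/IH nm].
  exact: subset_trans (Fdec m) nm.
have [u Fu] := choice F0.
have [x ux] : exists x, F_converges D u x.
  apply: cD; apply/F_cauchyP; first exact: Fmetric_ge0 hD.
  (* [diamF] yields a non-strict bound, hence its use at [e / 2]. *)
  move=> e e0; have [N FN] := diamF _ (divr_gt0 e0 (ltr0Sn R 1)).
  exists N => n m Nn Nm.
  apply: (@le_lt_trans _ _ (e / 2)); last by rewrite ltr_pdivrMr// ltr_pMr// ltr1n.
  by apply: FN; [exact: Fsub Nn _ (Fu n)|exact: Fsub Nm _ (Fu m)].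
have Fx n : F n x.
  apply: F_closed_limit (Fcl n) ux _.
  by exists n => // m nm; exact: Fsub nm _ (Fu m).
(* Uniqueness: [x] and any [y] of the intersection lie in every [F N], so their distance is at most
   every positive [e]. *)
exists x; apply/seteqP; split => [y Fy|_ -> n _]; last exact: Fx.
apply/(Fmetric_D1 hD)/eqP; rewrite eq_le (Fmetric_ge0 hD) andbT.
apply/ler_addgt0Pl => e /diamF[N FN]; rewrite addr0.
exact: FN (Fy N I) (Fx N).
Qed.

Lemma Cantor_F_complete :
  (forall F : nat -> set X,
     (forall n, F n.+1 `<=` F n) ->
     (forall n, F n !=set0) ->
     (forall n, F_closed D (F n)) ->
     F_diam D (F n) @[n --> \oo] --> (0%R%:E : \bar R) ->
     exists x : X, \bigcap_n F n = [set x]) ->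
  F_complete D.
Proof.
move=> cantor u /F_cauchyP cu; have {}cu := cu (Fmetric_ge0 hD).
(* The test sets are the adherences of the tails of [u]; their common point is the limit, because it
   shares the small set [F n] with [u n]. *)
pose F n := F_adherence [set u k | k in [set k | (n <= k)%N]].
have Fu n : F n (u n) by apply: subset_F_adherence; exists n => /=.
have smallF e : 0 < e -> exists N, forall n, (N <= n)%N ->
    forall x y, F n x -> F n y -> D x y < e.
  move=> /F_adherence_small[r /cu[N uN] Ar]; exists N => n Nn; apply: Ar.
  by move=> _ _ [k nk <-] [l nl <-]; apply: uN; exact: leq_trans Nn _.
have [] := cantor F.
- move=> n x Fx e /Fx[_ [k nk <-] xk].
  by exists (u k) => //; exists k => //; exact: ltnW.
- by move=> n; exists (u n).
- by move=> n; exact: F_closed_adherence.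
- apply/nneg_ereal_cvg0P.
    by move=> n; apply: F_diam_ge0; [exact: Fmetric_ge0 hD|exists (u n)].
  move=> e /smallF[N FN]; exists N => // n Nn.
  by apply: F_diam_le => x y Fx Fy; apply/ltW/(FN n).
move=> x capF; exists x; apply: F_converges_dist => e /smallF[N FN].
exists N => // n Nn; apply: (FN n) => //.
by have : (\bigcap_n F n) x by [rewrite capF]; exact.
Qed.

End Fmetric_theory.

Theorem theorem2p3 (R : realType) (X : Type) (hX : inhabited X)
    (D : X -> X -> R) (f : R -> R) (alpha : R)
    (hD : is_Fmetric D f alpha) :
  F_complete D <->
  (forall F : nat -> set X,
     (forall n, F n.+1 `<=` F n) ->
     (forall n, F n !=set0) ->
     (forall n, F_closed D (F n)) ->
     F_diam D (F n) @[n --> \oo] --> (0%R%:E : \bar R) ->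
     exists x : X, \bigcap_n F n = [set x]).
Proof.
split; first by move=> cD F; exact: (F_complete_Cantor hD).
exact: Cantor_F_complete hD.
Qed.
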